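(* Let $k>1$ be an integer. Then all positive integer solutions $(x,y)$ of the equation $x^{2}-(k^{2}-1)y^{2}=1$ are given by $$(x,y)=\left(\frac{V_{n}(2k,-1)}{2},U_{n}(2k,-1)\right)$$ with $n\geq 1$. That is, the set of pairs of positive integers solving the equation is exactly the set of these pairs as $n$ ranges over the integers $n\ge 1$.
   Context: For nonzero integers $m,s$ with $m^{2}+4s>0$, the generalized Fibonacci sequence is defined by $U_{0}(m,s)=0$, $U_{1}(m,s)=1$, $U_{n+1}(m,s)=mU_{n}(m,s)+sU_{n-1}(m,s)$ for $n\ge 1$, and the generalized Lucas sequence by $V_{0}(m,s)=2$, $V_{1}(m,s)=m$, $V_{n+1}(m,s)=mV_{n}(m,s)+sV_{n-1}(m,s)$ for $n\ge 1$. *)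

(* Defs.v *)
From mathcomp Require Import all_boot all_order all_algebra.

Set Implicit Arguments.
Unset Strict Implicit.
Unset Printing Implicit Defensive.

Import Order.TTheory GRing.Theory Num.Theory.
Local Open Scope ring_scope.

(* Defined for all integers m and s; in the theory one assumes m and s nonzero
   with m ^+ 2 + 4 * s > 0, which holds for m = 2 * k, s = -1 when 1 < k. *)
Fixpoint genFib (m s : int) (n : nat) {struct n} : int :=
  match n with
  | 0%N => 0
  | n'.+1 => match n' with
             | 0%N => 1
             | n''.+1 => m * genFib m s n' + s * genFib m s n''
             end
  end.

Fixpoint genLucas (m s : int) (n : nat) {struct n} : int :=
  match n with
  | 0%N => 2
  | n'.+1 => match n' with
             | 0%N => m
             | n''.+1 => m * genLucas m s n' + s * genLucas m s n''
             end
  end.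

(* Main.v *)
Require Import Defs.
From mathcomp Require Import all_boot all_order all_algebra.
From mathcomp Require Import zify ring.
Import Order.TTheory GRing.Theory Num.Theory.
Local Open Scope ring_scope.

(** The substitution [c = x + k * y] turns Pell's equation
    [x ^+ 2 - (k ^+ 2 - 1) * y ^+ 2 = 1] into the symmetric equation
    [c ^+ 2 - 2 * k * y * c + y ^+ 2 = 1].  For fixed [y] this is quadratic in
    [c] with root sum [2 * k * y], and it is symmetric in [y] and [c], so
    [(y, c) |-> (2 * k * y - c, y)] maps solutions to solutions (Vieta
    jumping).  This map is the recurrence of [genFib (2 * k) (-1)] run
    backwards.  On solutions with [0 < y < c] it preserves [0 <= y < c] and
    strictly decreases [y], so the descent stops at [y = 0], [c = 1], the
    initial values of the sequence: the solutions with [0 <= y < c] are exactly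
    the pairs of consecutive terms ([conic_consecutive_genFib] for one
    direction, [genFib_conic] and [genFib_growth] for the other).  Finally
    [x = c - k * y] is half a Lucas term, because
    [V_n = 2 * (U_n.+1 - k * U_n)] ([genLucas_genFib]). *)

Lemma genFibSS (m s : int) n :
  genFib m s n.+2 = m * genFib m s n.+1 + s * genFib m s n.
Proof. by []. Qed.

Lemma genLucasSS (m s : int) n :
  genLucas m s n.+2 = m * genLucas m s n.+1 + s * genLucas m s n.
Proof. by []. Qed.

Lemma genLucas_genFib (m s : int) n :
  genLucas m s n = 2 * genFib m s n.+1 - m * genFib m s n.
Proof.
suff [] : genLucas m s n = 2 * genFib m s n.+1 - m * genFib m s n /\
  genLucas m s n.+1 = 2 * genFib m s n.+2 - m * genFib m s n.+1 by [].
elim: n => [|n [IH0 IH1]]; first by split=> /=; ring.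
by split=> //; rewrite genLucasSS IH0 IH1 !genFibSS; ring.
Qed.

(** The quadratic form has discriminant [m ^+ 2 - 4] and is preserved by the
    companion matrix of the recurrence, whose determinant is 1. *)
Lemma genFib_conic (m : int) n :
  genFib m (-1) n.+1 ^+ 2 - m * genFib m (-1) n * genFib m (-1) n.+1
    + genFib m (-1) n ^+ 2 = 1.
Proof.
elim: n => [|n IH]; first by rewrite /=; ring.
by rewrite genFibSS -[RHS]IH; ring.
Qed.

(** The factor [k], rather than 1, is what makes [x = U_n.+1 - k * U_n]
    positive. *)
Lemma genFib_growth (k : int) n : 1 < k ->
  0 <= genFib (2 * k) (-1) n /\
  k * genFib (2 * k) (-1) n < genFib (2 * k) (-1) n.+1.
Proof.
move=> hk; elim: n => [|n [IH0 IH1]]; first by split=> //=; lia.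
by rewrite genFibSS; split; nia.
Qed.

(** Descent.  Writing [b' = 2 * k * b - c], the equation says
    [b' * c = b ^+ 2 - 1]: the right-hand side is nonnegative when [0 < b], so
    [0 <= b'], and it is less than [b * c], so [b' < b]. *)
Lemma conic_consecutive_genFib (k b c : int) : 0 <= b -> b < c ->
  c ^+ 2 - 2 * k * b * c + b ^+ 2 = 1 ->
  exists n, b = genFib (2 * k) (-1) n /\ c = genFib (2 * k) (-1) n.+1.
Proof.
have [N] := ubnP `|b|%N.
elim: N b c => // N IH b c hN b0 bc conic.
have [b_eq0|b_neq0] := eqVneq b 0.
  by exists 0%N; split=> //=; nia.
have b_gt0 : 0 < b by lia.
have vieta : (2 * k * b - c) * c = b ^+ 2 - 1.
  by rewrite -[X in _ = _ - X]conic; ring.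
have b'_ge0 : 0 <= 2 * k * b - c.
  by rewrite -(@pmulr_lge0 _ c) ?vieta //; nia.
have b'_lt : 2 * k * b - c < b.
  by rewrite -(@ltr_pM2r _ c) ?vieta //; nia.
have [||||n [eb' eb]] := IH (2 * k * b - c) b; rewrite //.
- by lia.
- by rewrite -[RHS]conic; ring.
by exists n.+1; split=> //; rewrite genFibSS -eb -eb'; ring.
Qed.

Theorem theorem17 (k : int) (hk : 1 < k) (x y : rat) :
  [/\ x \is a Num.int, y \is a Num.int, 0 < x, 0 < y
    & x ^+ 2 - (k%:~R ^+ 2 - 1) * y ^+ 2 = 1]
  <->
  exists n : nat, (1 <= n)%N /\
    (x, y) = ((genLucas (2 * k) (-1) n)%:~R / 2, (genFib (2 * k) (-1) n)%:~R).
Proof.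
have half_genLucas n : (genLucas (2 * k) (-1) n)%:~R / 2 =
    (genFib (2 * k) (-1) n.+1 - k * genFib (2 * k) (-1) n)%:~R :> rat.
  have -> : genLucas (2 * k) (-1) n =
      (genFib (2 * k) (-1) n.+1 - k * genFib (2 * k) (-1) n) * 2.
    by rewrite genLucas_genFib; ring.
  by rewrite intrM mulfK.
split=> [[/intrP[a ->] /intrP[b ->]]|[n [n_gt0]]].
  rewrite !ltr0z => a_gt0 b_gt0 pell.
  have {}pell : a ^+ 2 - (k ^+ 2 - 1) * b ^+ 2 = 1.
    apply: (@intr_inj rat).
    by rewrite !(rmorphB, rmorphM, rmorphXn) /= rmorph1.
  have [|||n [eb ec]] := @conic_consecutive_genFib k b (a + k * b).
  - exact: ltW.
  - by nia.
  - by rewrite -[RHS]pell; ring.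
  exists n; split.
    (* [U_0 = 0], whereas [b] is positive. *)
    by case: n eb {ec} => // eb; rewrite eb ltxx in b_gt0.
  by rewrite half_genLucas -ec -eb addrK.
rewrite half_genLucas => -[-> ->].
have [_ growth] := genFib_growth k n hk.
have fib_gt0 : 0 < genFib (2 * k) (-1) n.
  case: n n_gt0 {growth} => // n _.
  by have [fib_ge0] := genFib_growth k n hk; nia.
split; rewrite ?intr_int ?ltr0z ?subr_gt0 //.
rewrite -[RHS]/((1 : int)%:~R) -[X in _ = X%:~R](genFib_conic (2 * k) n).
by rewrite !(rmorphB, rmorphD, rmorphM, rmorphXn) /=; ring.
Qed.
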